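(* Let $f:\{0,1\}^n\to\{0,1\}$ be a partial function. Then $\mathrm{RS}(f)\ge\mathrm{RC}(f)/4$.
   Context: Partial means $f$ is defined on a subset $\mathrm{Dom}(f)\subseteq\{0,1\}^n$. For $x\in\{0,1\}^n$ and a block $B\subseteq[n]$, $x^B$ is $x$ with the bits in $B$ flipped; $B$ is a sensitive block of $x$ if $x,x^B\in\mathrm{Dom}(f)$ and $f(x)\ne f(x^B)$. $\mathrm{RC}_x(f)$ is the maximum total weight of an assignment of non-negative weights to the sensitive blocks of $x$ such that for every $i\in[n]$ the total weight of blocks containing $i$ is at most $1$; $\mathrm{RC}(f)=\max_{x\in\mathrm{Dom}(f)}\mathrm{RC}_x(f)$. A randomized query algorithm is a probability distribution over deterministic decision trees; $\mathrm{R}_0(h)$ is the minimum, over randomized algorithms always correct on every input in the domain of $h$, of the maximum over inputs of the expected number of queries. Query notions apply to alphabet $\{0,1,*,\dagger\}$. Sabotage: $P_f\subseteq\{0,1,*\}^n$ is the set of $p$ for which there exist $x,y\in\mathrm{Dom}(f)$ with $f(x)\ne f(y)$ and $x_i=y_i=p_i$ whenever $p_i\ne*$; $P_f^\dagger$ is the same with $\dagger$ in place of $*$; $Q_f=P_f\cup P_f^\dagger$; $f_{\mathrm{sab}}:Q_f\to\{0,1\}$ is $0$ on $P_f$ and $1$ on $P_f^\dagger$; $\mathrm{RS}(f)=\mathrm{R}_0(f_{\mathrm{sab}})$. *)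

(* Defs.v *)
From HB Require Import structures.
From mathcomp Require Import all_boot all_order all_algebra.
From mathcomp Require Import boolp classical_sets reals ereal esum.

Set Implicit Arguments.
Unset Strict Implicit.
Unset Printing Implicit Defensive.

Import Order.TTheory GRing.Theory Num.Theory.
Local Open Scope ring_scope.

(* A partial function on a finite set of inputs is an [option]-valued total
   function, [None] meaning "undefined". *)
Definition Dom (X : finType) (Y : Type) (h : X -> option Y) : {set X} :=
  finset (fun x => isSome (h x)).

Definition input (n : nat) := {ffun 'I_n -> bool}.

Definition flip n (x : input n) (B : {set 'I_n}) : input n :=
  [ffun i => (i \in B) (+) x i].

Definition sensitive_block n (f : input n -> option bool) (x : input n)
    (B : {set 'I_n}) : bool :=
  [&& x \in Dom f, flip x B \in Dom f & f x != f (flip x B)].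

Definition feasible_weights (R : realType) n (f : input n -> option bool)
    (x : input n) (w : {set 'I_n} -> R) : Prop :=
  (forall B, sensitive_block f x B -> 0 <= w B) /\
  (forall i : 'I_n, \sum_(B | sensitive_block f x B && (i \in B)) w B <= 1).

(* The supremum is over a nonempty compact set of values, hence a maximum: the
   empty block is never sensitive, so every relevant weight is at most 1. *)
Definition RCx (R : realType) n (f : input n -> option bool) (x : input n) :
    \bar R :=
  ereal_sup (fun v => exists2 w : {set 'I_n} -> R, feasible_weights f x w &
                        v = (\sum_(B | sensitive_block f x B) w B)%:E).

(* [RCx] is nonnegative, so 0 only matters when [Dom f] is empty. *)
Definition RC (R : realType) n (f : input n -> option bool) : \bar R :=
  \big[maxe/0%E]_(x in Dom f) RCx R f x.

Inductive symbol := Bit of bool | Star | Dagger.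

Definition symbol_code (s : symbol) : bool + bool :=
  match s with Bit b => inl b | Star => inr false | Dagger => inr true end.

Definition symbol_decode (c : bool + bool) : symbol :=
  match c with inl b => Bit b | inr false => Star | inr true => Dagger end.

Lemma symbol_codeK : cancel symbol_code symbol_decode.
Proof. by case. Qed.

HB.instance Definition _ := Equality.copy symbol (can_type symbol_codeK).
HB.instance Definition _ := Choice.copy symbol (can_type symbol_codeK).
HB.instance Definition _ := Countable.copy symbol (can_type symbol_codeK).
HB.instance Definition _ := Finite.copy symbol (can_type symbol_codeK).

Definition word (n : nat) := {ffun 'I_n -> symbol}.

Inductive dtree (n : nat) : Type :=
| Leaf of bool
| Query of 'I_n & (symbol -> dtree n).

(* Summation over a type ([esum]) asks for a choiceType; the classical
   instances suffice. *)
HB.instance Definition _ n := gen_eqMixin (dtree n).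
HB.instance Definition _ n := gen_choiceMixin (dtree n).

Fixpoint eval n (t : dtree n) (p : word n) : bool :=
  match t with
  | Leaf b => b
  | Query i k => eval (k (p i)) p
  end.

Fixpoint num_queries n (t : dtree n) (p : word n) : nat :=
  match t with
  | Leaf _ => 0
  | Query i k => (num_queries (k (p i)) p).+1
  end.

(* A probability mass function on all deterministic trees, including those that
   repeat queries. Its support may be infinite. *)
Definition randomized_algorithm (R : realType) n (mu : dtree n -> R) : Prop :=
  (forall t, 0 <= mu t) /\ (\esum_(t in [set: dtree n]) (mu t)%:E = 1)%E.

Definition always_correct (R : realType) n (h : word n -> option bool)
    (mu : dtree n -> R) : Prop :=
  forall t, 0 < mu t -> forall p, p \in Dom h -> h p = Some (eval t p).

Definition expected_queries (R : realType) n (mu : dtree n -> R) (p : word n) :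
    \bar R :=
  \esum_(t in [set: dtree n]) (mu t * (num_queries t p)%:R)%:E.

(* The worst case is 0 when [Dom h] is empty. *)
Definition worst_case_queries (R : realType) n (h : word n -> option bool)
    (mu : dtree n -> R) : \bar R :=
  \big[maxe/0%E]_(p in Dom h) expected_queries mu p.

(* The infimum is attained: the trees that never repeat a query are finitely
   many, suffice, and include an always correct one. *)
Definition R0 (R : realType) n (h : word n -> option bool) : \bar R :=
  ereal_inf (fun v => exists2 mu : dtree n -> R,
    randomized_algorithm mu /\ always_correct h mu &
    v = worst_case_queries h mu).

(* [sabotaged f Star] is P_f, [sabotaged f Dagger] is P_f^dagger. *)
Definition sabotaged n (f : input n -> option bool) (s : symbol) :
    {set word n} :=
  finset (fun p : word n => [exists x in Dom f, exists y in Dom f,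
    (f x != f y) &&
    [forall i, (p i != s) ==> (Bit (x i) == p i) && (Bit (y i) == p i)]]).

(* The order of the tests is immaterial: [sabotaged f Star] and
   [sabotaged f Dagger] are disjoint, see [sabotaged_disjoint]. *)
Definition fsab n (f : input n -> option bool) (p : word n) : option bool :=
  if p \in sabotaged f Star then Some false
  else if p \in sabotaged f Dagger then Some true
  else None.

Lemma sabotaged_disjoint n (f : input n -> option bool) :
  [disjoint sabotaged f Star & sabotaged f Dagger].
Proof.
apply/pred0P => p /=; apply/negP => /andP[].
rewrite !inE => /exists_inP[x _ /exists_inP[y _ /andP[fxy /forallP H]]].
case/exists_inP=> x' _ /exists_inP[y' _ /andP[_ /forallP H']].
case/eqP: fxy; congr f; apply/ffunP => i.
have pS : p i != Star.
  by apply/eqP => pE; have := H' i; rewrite pE.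
have /andP[/eqP ex /eqP ey] := implyP (H i) pS.
by move: ex; rewrite -ey => -[].
Qed.

Definition RS (R : realType) n (f : input n -> option bool) : \bar R :=
  R0 R (fsab f).

(* Main.v *)
(* Fix an input x and weights w on its sensitive blocks, of total weight W.  For
   a sensitive block B let p_B be x with the bits of B erased (replaced by a
   star).  A correct tree must query B on p_B, and until it does so it follows
   its path on x; since each index carries weight at most 1, the blocks met by
   the first k queries of that path have total weight at most k.  So the blocks B
   with more than k queries on p_B weigh at least W - k, and summing over
   k <= W shows that the w-weighted number of queries is at least W^2 / 2.
   Averaging over the trees, some p_B costs at least W / 2 in expectation. *)
Require Import Defs.
From mathcomp Require Import all_boot all_order all_algebra.
From mathcomp Require Import boolp classical_sets reals ereal esum.
From mathcomp Require Import fsbigop zify ring lra.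

Set Implicit Arguments.
Unset Strict Implicit.
Unset Printing Implicit Defensive.

Import Order.TTheory GRing.Theory Num.Theory.
Local Open Scope ring_scope.

Section Trees.
Variable n : nat.
Implicit Types (t : dtree n) (x : input n) (B : {set 'I_n}) (s : symbol).

Fixpoint queried t (p : word n) : seq 'I_n :=
  match t with
  | Leaf _ => [::]
  | Query i k => i :: queried (k (p i)) p
  end.

Definition bits x : word n := [ffun i => Bit (x i)].

Definition erase x B s : word n := [ffun i => if i \in B then s else Bit (x i)].

(** Outside [B] both erasures agree with [x], so the three runs coincide until a query falls in [B];
    without such a query the two outputs would be equal. That query is already made on
    [erase x B s], hence the length of the prefix. *)
Lemma eval_erase_neq t x B s s' :
  Defs.eval t (erase x B s) != Defs.eval t (erase x B s') ->
  has (mem B) (take (num_queries t (erase x B s)) (queried t (bits x))).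
Proof.
elim: t => [b|i k IH] /=; first by rewrite eqxx.
rewrite !ffunE; case: ifPn => //= _; exact: IH.
Qed.

Lemma erase_sabotaged (f : input n -> option bool) x B s :
  sensitive_block f x B -> erase x B s \in sabotaged f s.
Proof.
case/and3P=> xD yD fxy; rewrite inE.
apply/exists_inP; exists x => //; apply/exists_inP; exists (flip x B) => //.
rewrite fxy /=; apply/forallP => i; rewrite !ffunE.
by case: ifPn => [_|_]; rewrite ?eqxx // implybT.
Qed.

Lemma fsab_erase_star (f : input n -> option bool) x B :
  sensitive_block f x B -> fsab f (erase x B Star) = Some false.
Proof. by move=> sB; rewrite /fsab erase_sabotaged. Qed.

Lemma fsab_erase_dagger (f : input n -> option bool) x B :
  sensitive_block f x B -> fsab f (erase x B Dagger) = Some true.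
Proof.
move=> sB; have pD := erase_sabotaged Dagger sB.
by rewrite /fsab pD (disjointFl (sabotaged_disjoint f) pD).
Qed.

End Trees.

(** A union bound: each [j] hit by [q] is counted at least once on the right, and repetitions in [q]
    only enlarge that side. *)
Lemma sum_has_le (R : numDomainType) (I : eqType) (J : finType) (P : pred J)
    (w : J -> R) (r : J -> pred I) (q : seq I) :
  (forall j, P j -> 0 <= w j) ->
  \sum_(j | P j && has (r j) q) w j <= \sum_(i <- q) \sum_(j | P j && r j i) w j.
Proof.
move=> w0; under [leRHS]eq_bigr do rewrite big_mkcondr.
rewrite exchange_big /= big_mkcondr; apply: ler_sum => j Pj.
elim: q => [|i q IH] /=; first by rewrite big_nil.
rewrite big_cons; have [_|_ /=] := boolP (r j i).
  rewrite /= lerDl; apply: sumr_ge0 => k _.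
  by case: ifP => // _; apply: w0.
by rewrite add0r.
Qed.

Section Weights.
Variables (R : realType) (n : nat) (f : input n -> option bool).
Implicit Types (t : dtree n) (x : input n) (w : {set 'I_n} -> R).

Lemma weight_few_queries x w t k : feasible_weights f x w ->
  (forall B, sensitive_block f x B ->
     Defs.eval t (erase x B Star) != Defs.eval t (erase x B Dagger)) ->
  \sum_(B | sensitive_block f x B &&
            (num_queries t (erase x B Star) <= k)%N) w B <= k%:R.
Proof.
move=> [w0 w1] ct; set q := take k (queried t (bits x)).
apply: (@le_trans _ _
  (\sum_(B | sensitive_block f x B && has (mem B) q) w B)).
  rewrite big_mkcondr [leRHS]big_mkcondr; apply: ler_sum => B sB.
  case: ifPn => [le_k|_]; last by case: ifP => // _; apply: w0.
  (* [q] comes from the run on [x], so it is the same list for all blocks; it extends the prefix in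
     which [eval_erase_neq] finds an index of [B]. *)
  suff -> : has (mem B) q by [].
  move: (eval_erase_neq (ct B sB)).
  rewrite -(take_takel _ le_k) -/q => /hasP[i /mem_take iq iB].
  by apply/hasP; exists i.
apply: le_trans (sum_has_le (fun B : {set 'I_n} => mem B) q w0) _.
apply: (@le_trans _ _ (\sum_(i <- q) 1)).
  by apply: ler_sum => i _; apply: w1.
by rewrite big_const_seq count_predT iter_addr_0 ler_nat size_take_min geq_minl.
Qed.

Lemma sum_subn (W : R) N :
  \sum_(k < N) (W - k%:R) = N%:R * (2 * W - N%:R + 1) / 2.
Proof.
elim: N => [|N IH]; first by rewrite big_ord0 mul0r mul0r.
by rewrite big_ord_recr /= IH -natr1; field.
Qed.

Lemma weighted_queries_ge x w t : feasible_weights f x w ->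
  (forall B, sensitive_block f x B ->
     Defs.eval t (erase x B Star) != Defs.eval t (erase x B Dagger)) ->
  (\sum_(B | sensitive_block f x B) w B) ^+ 2 / 2 <=
  \sum_(B | sensitive_block f x B) w B * (num_queries t (erase x B Star))%:R.
Proof.
move=> fw ct; set W := \sum_(B | _) w B.
have W0 : 0 <= W by apply: sumr_ge0 => B; apply: fw.1.
have /andP[] := truncn_itv W0; set m := Num.truncn W => lemW ltWm.
(* With [M] the integer part of [W], the sum is (M+1)(2W-M)/2, and (M+1)(2W-M) - W^2 = (M+1-W)W +
   (M+1)(W-M), where both products are nonnegative. *)
apply: (@le_trans _ _ (\sum_(k < m.+1) (W - k%:R))).
  rewrite sum_subn; move: ltWm; rewrite -natr1.
  move: (m%:R : R) lemW => M leMW ltWM.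
  have WMW : 0 <= (M + 1 - W) * W by apply: mulr_ge0; lra.
  have MWM : 0 <= (M + 1) * (W - M) by apply: mulr_ge0; lra.
  lra.
apply: (@le_trans _ _ (\sum_(k < m.+1) \sum_(B | sensitive_block f x B)
   w B * (k < num_queries t (erase x B Star))%N%:R)).
  apply: ler_sum => k _; rewrite lerBlDr.
  apply: le_trans (lerD (lexx _) (weight_few_queries k fw ct)).
  rewrite [X in _ + X]big_mkcondr -big_split /=; apply: ler_sum => B _.
  by rewrite ltnNge; case: leqP => _ /=; rewrite ?mulr0 ?mulr1 ?add0r ?addr0.
rewrite exchange_big; apply: ler_sum => B sB /=.
rewrite -mulr_sumr; apply: ler_wpM2l; first exact: fw.1.
rewrite -natr_sum ler_nat; set j := num_queries _ _.
(* Layer-cake count: at most [j] of the thresholds [k] lie below [j]. *)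
suff -> : (\sum_(k < m.+1) (k < j) = minn m.+1 j)%N by exact: geq_minr.
elim: m.+1 => [|N IH]; first by rewrite big_ord0 min0n.
by rewrite big_ord_recr /= IH; case: (ltnP N j); lia.
Qed.

End Weights.

Local Open Scope ereal_scope.

(** A positive factor passes through the supremum of the finite partial sums; for [c = 0] both sides
    vanish, even if the sum is infinite. *)
Lemma ge0_esumZl (R : realType) (T : choiceType) (S : set T) (c : R)
    (a : T -> \bar R) : (0 <= c)%R -> (forall t, 0 <= a t) ->
  \esum_(t in S) (c%:E * a t) = c%:E * \esum_(t in S) a t.
Proof.
rewrite le_eqVlt => /predU1P[<- _|c0 a0].
  by rewrite mul0e esum1// => t _; rewrite mul0e.
rewrite /esum -ereal_sup_pZl// image_comp; congr ereal_sup.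
by apply: eq_imagel => A [finA AS] /=; rewrite ge0_mule_fsumr.
Qed.

(** Bounding each [e j] by [v] turns the hypothesis into W^2/2 <= W v, from which W cancels when
    positive; W = 0 is where [0 <= v] enters. *)
Lemma ereal_le_of_weighted (R : realType) (J : finType) (P : pred J)
    (w : J -> R) (e : J -> \bar R) (v : \bar R) :
  (forall j, P j -> (0 <= w j)%R) -> (forall j, P j -> e j <= v) -> 0 <= v ->
  ((\sum_(j | P j) w j) ^+ 2 / 2)%:E <= \sum_(j | P j) (w j)%:E * e j ->
  (\sum_(j | P j) w j)%:E / 2%:E <= v.
Proof.
move=> w0 ev v0; set W := (\sum_(j | _) _)%R => H.
have : (0 <= W)%R by apply: sumr_ge0.
rewrite le_eqVlt => /predU1P[<-|W0]; first by rewrite mul0e.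
have : \sum_(j | P j) (w j)%:E * e j <= W%:E * v.
  rewrite /W -sumEFin ge0_sume_distrl//.
  by apply: lee_sum => j Pj; apply: lee_wpmul2l; [rewrite lee_fin w0|exact: ev].
move=> /(le_trans H).
rewrite inver pnatr_eq0/= -lee_pdivrMl// -!EFinM.
by rewrite mulrA expr2 mulKf ?gt_eqF.
Qed.

Theorem theorem31 (R : realType) (n : nat) (f : input n -> option bool) :
  RC R f / 4%:E <= RS R f.
Proof.
apply: le_ereal_inf_tmp => _ [mu [[mu0 mu1] mu_correct] ->].
set v := worst_case_queries _ mu.
have v0 : 0 <= v by exact: bigmax_ge_id.
rewrite inver pnatr_eq0/= lee_pdivrMr//.
apply: bigmax_le => [|x xD]; first exact: mule_ge0.
apply: ge_ereal_sup => _ [w fw ->].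
have ct t : (0 < mu t)%R -> forall B, sensitive_block f x B ->
    Defs.eval t (erase x B Star) != Defs.eval t (erase x B Dagger).
  (* The two erasures of [B] have different values under [fsab f], so a tree in the support must
     separate them. *)
  move=> mut B sB; apply/eqP => eqt.
  have := mu_correct t mut (erase x B Star).
  have := mu_correct t mut (erase x B Dagger).
  rewrite eqt !inE fsab_erase_star// fsab_erase_dagger//.
  by move=> /(_ isT)[<-] /(_ isT)[].
have ev B : sensitive_block f x B -> expected_queries mu (erase x B Star) <= v.
  move=> sB; apply: (le_bigmax_cond _ (expected_queries mu)).
  by rewrite inE fsab_erase_star.
have avg : ((\sum_(B | sensitive_block f x B) w B) ^+ 2 / 2)%:E <=
    \sum_(B | sensitive_block f x B)
      (w B)%:E * expected_queries mu (erase x B Star).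
  have q0 t B : 0 <= (mu t * (num_queries t (erase x B Star))%:R)%:E.
    by rewrite lee_fin mulr_ge0.
  under [leRHS]eq_bigr => B sB do
    rewrite /expected_queries -ge0_esumZl ?(fw.1 B sB)//.
  rewrite -esum_sum => [|t B _ sB]; last by rewrite mule_ge0// lee_fin fw.1.
  (* Writing 1 as the total mass of [mu] reduces the claim to one inequality per tree. *)
  rewrite -[leLHS]mule1 -mu1 -ge0_esumZl ?divr_ge0 ?sqr_ge0//.
  apply: le_esum => t _; rewrite -EFinM; under [leRHS]eq_bigr do rewrite -EFinM.
  rewrite sumEFin lee_fin; have := mu0 t.
  (* A tree of mass 0 may err, but then both sides are 0. *)
  rewrite le_eqVlt => /predU1P[<-|mut].
    by rewrite mulr0 big1// => B _; rewrite mul0r mulr0.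
  under [leRHS]eq_bigr do rewrite mulrCA.
  by rewrite -mulr_sumr mulrC ler_wpM2l// weighted_queries_ge// => B; apply: ct.
have := ereal_le_of_weighted fw.1 ev v0 avg.
(* The argument gives the constant 2, which is weakened to 4 here. *)
rewrite inver pnatr_eq0/= lee_pdivrMr// => /le_trans; apply.
by rewrite lee_wpmul2l// lee_fin ler_nat.
Qed.
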